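(* Let $\mathcal{A}$ be a $C^*$-algebra or an $H^*$-algebra, let $W$ be a Hilbert $\mathcal{A}$-module, $V$ a submodule of $W$, and $\varphi : V \to W$ a morphism such that $\varphi(V) \subseteq V^{\perp}$. Let $W_0 := V \oplus \varphi(V) \leq W$. Suppose that $G$ is a uniquely 2-divisible abelian group and that $f : W \to G$ is an orthogonally additive mapping. Then the following holds: (i) There exist mappings $T : W \to G$ and $B : W \times W \to G$ such that $T$ is additive on $W_0$, $B$ is symmetric biadditive orthogonality preserving on $W_0 \times W_0$, and $$f(x)=T(x)+B(x,x)\quad \text{for all } x \in W_0.$$ (ii) If $G$ is a complex normed space and $f$ is continuous, then there exist continuous mappings $T : W \to G$ and $S : W \times W \to G$ such that $T$ is additive on $W_0$, $S$ is sesquilinear orthogonality preserving on $W_0 \times W_0$, and $$f(x)=T(x)+S(x,x)\quad \text{for all } x \in W_0.$$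
   Context: An $H^*$-algebra is a complex Banach $*$-algebra whose underlying Banach space is a Hilbert space with inner product $\langle\cdot,\cdot\rangle$ satisfying $\langle ab,c\rangle=\langle b,a^*c\rangle$ and $\langle ba,c\rangle=\langle b,ca^*\rangle$ for all $a,b,c$. Its trace-class is $\tau(\mathcal{A})=\{ab : a,b\in\mathcal{A}\}$. An element $a$ of a $C^*$-algebra is positive if it is self-adjoint with nonnegative spectrum; an element $a$ of an $H^*$-algebra is positive if $\langle ax,x\rangle\ge 0$ for all $x\in\mathcal{A}$. Let $\mathcal{A}$ be a $C^*$-algebra or an $H^*$-algebra. An inner product $\mathcal{A}$-module is a right $\mathcal{A}$-module $W$ that is a complex linear space with $\lambda(xa)=(\lambda x)a=x(\lambda a)$, together with a generalized inner product $\langle\cdot,\cdot\rangle$ from $W\times W$ to $\mathcal{A}$ (if $\mathcal{A}$ is a $C^*$-algebra), respectively to $\tau(\mathcal{A})$ (if $\mathcal{A}$ is an $H^*$-algebra), such that $\langle x,y+z\rangle=\langle x,y\rangle+\langle x,z\rangle$, $\langle x,ya\rangle=\langle x,y\rangle a$, $\langle x,y\rangle^*=\langle y,x\rangle$, $\langle x,x\rangle\ge0$, and $\langle x,x\rangle=0\Leftrightarrow x=0$. It is a Hilbert $\mathcal{A}$-module if it is complete with respect to $\|x\|_W=\|\langle x,x\rangle\|^{1/2}$, where $\|\cdot\|$ is the norm of $\mathcal{A}$. For a submodule $V$ of $W$, $V^\perp=\{x\in W : \langle x,y\rangle=0 \text{ for all } y\in V\}$. A morphism $\varphi:V\to W$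 is a mapping with $\langle\varphi(x),\varphi(y)\rangle=\langle x,y\rangle$ for all $x,y\in V$ (such maps are automatically continuous and $\mathcal{A}$-linear). A mapping $f:W\to G$ is orthogonally additive if $\langle x,y\rangle=0$ implies $f(x+y)=f(x)+f(y)$. A mapping $B:W\times W\to G$ is orthogonality preserving (on $W_0\times W_0$) if $\langle x,y\rangle=0$ implies $B(x,y)=0$ (for $x,y\in W_0$). Biadditive means additive in each variable; sesquilinear means linear in the first and conjugate linear in the second variable. *)

(* Defs.v *)
From HB Require Import structures.
From mathcomp Require Import all_boot all_order all_algebra.
From mathcomp Require Import all_classical all_reals all_analysis.
From mathcomp Require Import complex.

Set Implicit Arguments.
Unset Strict Implicit.
Unset Printing Implicit Defensive.

Import Order.TTheory GRing.Theory Num.Theory.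
Import numFieldNormedType.Exports.

Local Open Scope classical_set_scope.
Local Open Scope complex_scope.
Local Open Scope ring_scope.

(* Complex Banach *-algebras.  Neither a unit nor an isometric involution is
   assumed, so MathComp's (unital) algebra structures do not apply.  As
   everywhere below, norms take values in R[i], where 0 <= z means that z is
   real and nonnegative. *)
Record banach_star_algebra (R : realType) := BanachStarAlgebra {
  bsa_space :> completeNormedModType R[i];
  amul : bsa_space -> bsa_space -> bsa_space;
  astar : bsa_space -> bsa_space;
  amulA : forall a b c, amul a (amul b c) = amul (amul a b) c;
  amulPl : forall (l : R[i]) a b c,
    amul (l *: a + b) c = l *: amul a c + amul b c;
  amulPr : forall (l : R[i]) a b c,
    amul a (l *: b + c) = l *: amul a b + amul a c;
  anormM : forall a b, `|amul a b| <= `|a| * `|b|;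
  astarP : forall (l : R[i]) a b,
    astar (l *: a + b) = Num.conj l *: astar a + astar b;
  astarM : forall a b, astar (amul a b) = amul (astar b) (astar a);
  astarK : forall a, astar (astar a) = a }.

Arguments amul {R _} _ _.
Arguments astar {R _} _.

Record cstar_algebra (R : realType) := CStarAlgebra {
  cstar_base :> banach_star_algebra R;
  cstar_identity : forall a : cstar_base, `|amul (astar a) a| = `|a| ^+ 2 }.

Record hstar_algebra (R : realType) := HStarAlgebra {
  hstar_base :> banach_star_algebra R;
  hip : hstar_base -> hstar_base -> R[i];
  hip_linearl : forall (l : R[i]) a b c,
    hip (l *: a + b) c = l * hip a c + hip b c;
  hip_conj : forall a b, hip b a = Num.conj (hip a b);
  hip_ge0 : forall a, 0 <= hip a a;
  hip_norm : forall a, `|a| = sqrtC (hip a a);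
  hip_adjl : forall a b c, hip (amul a b) c = hip b (amul (astar a) c);
  hip_adjr : forall a b c, hip (amul b a) c = hip b (amul c (astar a)) }.

Section Positivity.
Variable R : realType.

Section Spectrum.
Variable A : banach_star_algebra R.

Definition is_unit_elt (e : A) : Prop :=
  forall a : A, amul e a = a /\ amul a e = a.

Definition invertible_wrt (e a : A) : Prop :=
  exists b : A, amul a b = e /\ amul b a = e.

(* Unitization: (l, a) stands for l 1 + a. *)
Definition unitization_mul (p q : R[i] * A) : R[i] * A :=
  (p.1 * q.1, p.1 *: q.2 + q.1 *: p.2 + amul p.2 q.2).

Definition unitization_invertible (p : R[i] * A) : Prop :=
  exists q, unitization_mul p q = (1, 0) /\ unitization_mul q p = (1, 0).

(* The spectrum is taken in A if A is unital, in its unitization otherwise. *)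
Definition spectrum (a : A) : set R[i] := [set l |
  (exists e : A, is_unit_elt e /\ ~ invertible_wrt e (l *: e - a)) \/
  (~ (exists e : A, is_unit_elt e) /\ ~ unitization_invertible (l, - a))].

End Spectrum.

Definition cstar_positive (A : cstar_algebra R) : set A :=
  [set a | astar a = a /\ forall l, spectrum a l -> 0 <= l].

Definition hstar_positive (A : hstar_algebra R) : set A :=
  [set a | forall x : A, 0 <= hip (amul a x) x].

Definition trace_class (A : hstar_algebra R) : set A :=
  [set c | exists a b : A, c = amul a b].

End Positivity.

Variant coef_algebra (R : realType) :=
  | CStarCoef of cstar_algebra R
  | HStarCoef of hstar_algebra R.

Definition coef_base (R : realType) (A : coef_algebra R) :
    banach_star_algebra R :=
  match A with
  | CStarCoef A' => A'
  | HStarCoef A' => A'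
  end.
Coercion coef_base : coef_algebra >-> banach_star_algebra.

Definition coef_positive (R : realType) (A : coef_algebra R) : set A :=
  match A return set (coef_base A) with
  | CStarCoef A' => @cstar_positive R A'
  | HStarCoef A' => @hstar_positive R A'
  end.

(* The set in which generalized inner products take their values. *)
Definition coef_range (R : realType) (A : coef_algebra R) : set A :=
  match A return set (coef_base A) with
  | CStarCoef A' => setT
  | HStarCoef A' => @trace_class R A'
  end.

Record hilbert_module (R : realType) (A : coef_algebra R) := HilbertModule {
  hm_space :> completeNormedModType R[i];
  act : hm_space -> A -> hm_space;
  inner : hm_space -> hm_space -> A;
  actDl : forall x y a, act (x + y) a = act x a + act y a;
  actDr : forall x a b, act x (a + b) = act x a + act x b;
  actM : forall x a b, act x (amul a b) = act (act x a) b;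
  act_scalel : forall (l : R[i]) x a, l *: act x a = act (l *: x) a;
  act_scaler : forall (l : R[i]) x a, act (l *: x) a = act x (l *: a);
  inner_range : forall x y, coef_range (inner x y);
  innerDr : forall x y z, inner x (y + z) = inner x y + inner x z;
  inner_act : forall x y a, inner x (act y a) = amul (inner x y) a;
  inner_star : forall x y, astar (inner x y) = inner y x;
  inner_ge0 : forall x, coef_positive (inner x x);
  inner_eq0 : forall x, inner x x = 0 <-> x = 0;
  hm_norm : forall x, `|x| = sqrtC `|inner x x| }.

Arguments act {R A _} _ _.
Arguments inner {R A _} _ _.

Section Modules.
Variables (R : realType) (A : coef_algebra R) (W : hilbert_module A).

Definition submodule (V : set W) : Prop :=
  [/\ V 0, forall x y, V x -> V y -> V (x + y),
      forall (l : R[i]) x, V x -> V (l *: x) &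
      forall x (a : A), V x -> V (act x a)].

Definition orthocomplement (V : set W) : set W :=
  [set x | forall y, V y -> inner x y = 0].

(* A morphism V -> W is represented by a total function on W of which only
   the values on V matter. *)
Definition morphism_on (V : set W) (phi : W -> W) : Prop :=
  forall x y, V x -> V y -> inner (phi x) (phi y) = inner x y.

Definition sum_set (V U : set W) : set W :=
  [set z | exists x y, [/\ V x, U y & z = x + y]].

Definition orthogonally_additive (G : zmodType) (f : W -> G) : Prop :=
  forall x y, inner x y = 0 -> f (x + y) = f x + f y.

Definition additive_on (G : zmodType) (W0 : set W) (T : W -> G) : Prop :=
  forall x y, W0 x -> W0 y -> T (x + y) = T x + T y.

Definition orthogonality_preserving_on (G : zmodType) (W0 : set W)
    (B : W -> W -> G) : Prop :=
  forall x y, W0 x -> W0 y -> inner x y = 0 -> B x y = 0.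

Definition symmetric_on (G : zmodType) (W0 : set W) (B : W -> W -> G) : Prop :=
  forall x y, W0 x -> W0 y -> B x y = B y x.

Definition biadditive_on (G : zmodType) (W0 : set W) (B : W -> W -> G) : Prop :=
  forall x y z, W0 x -> W0 y -> W0 z ->
    B (x + y) z = B x z + B y z /\ B x (y + z) = B x y + B x z.

Definition sesquilinear_on (G : lmodType R[i]) (W0 : set W)
    (S : W -> W -> G) : Prop :=
  forall (l : R[i]) x y z, W0 x -> W0 y -> W0 z ->
    S (l *: x + y) z = l *: S x z + S y z /\
    S x (l *: y + z) = Num.conj l *: S x y + S x z.

End Modules.

Definition uniquely_2_divisible (G : zmodType) : Prop :=
  forall g : G, exists! h : G, h *+ 2 = g.

(* Main.v *)
Require Import Defs.
From mathcomp Require Import all_boot all_order all_algebra.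
From mathcomp Require Import all_classical all_reals all_analysis.
From mathcomp Require Import complex.
Import Order.TTheory GRing.Theory Num.Theory.
Import numFieldNormedType.Exports.
Local Open Scope classical_set_scope.
Local Open Scope complex_scope.
Local Open Scope ring_scope.

(* Write W0 = V + phi(V).  For s, t in V and a scalar l with |l| = 1, the
   vectors s + l phi(s) and t - l phi(t) are orthogonal, so an orthogonally
   additive f satisfies
     f(s + t) + f(l phi(s - t)) = f(s) + f(l phi(s)) + f(t) + f(- l phi(t)).
   If f is odd, adding the equation with s and t exchanged shows that f is
   additive on V, hence on phi(V) and on W0.  If f is even, comparing t = s
   with t = - s gives f(l phi(s)) = f(s), so the equation becomes the
   parallelogram law: f is quadratic on W0, and polarization yields B.  Taking
   both l = 1 and l = i gives f(i x) = f(x) for even f, so that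
   S(x, y) = B(x, y) + i B(x, i y) is sesquilinear when f is continuous. *)

Set Implicit Arguments.
Unset Strict Implicit.
Unset Printing Implicit Defensive.

(** * Elementary identities in a Banach *-algebra *)

Section StarAlgebra.
Variables (R : realType) (A : banach_star_algebra R).
Implicit Types (a b c : A) (l : R[i]).

Lemma amulDl a b c : amul (a + b) c = amul a c + amul b c.
Proof. by have := amulPl 1 a b c; rewrite !scale1r. Qed.

Lemma amulDr a b c : amul a (b + c) = amul a b + amul a c.
Proof. by have := amulPr 1 a b c; rewrite !scale1r. Qed.

Lemma amul0l a : amul 0 a = 0.
Proof. by apply: (addrI (amul 0 a)); rewrite -amulDl !addr0. Qed.

Lemma amul0r a : amul a 0 = 0.
Proof. by apply: (addrI (amul a 0)); rewrite -amulDr !addr0. Qed.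

Lemma amulZl l a b : amul (l *: a) b = l *: amul a b.
Proof. by have := amulPl l a 0 b; rewrite amul0l !addr0. Qed.

Lemma amulZr l a b : amul a (l *: b) = l *: amul a b.
Proof. by have := amulPr l a b 0; rewrite amul0r !addr0. Qed.

Lemma astarD a b : astar (a + b) = astar a + astar b.
Proof. by have := astarP 1 a b; rewrite conjC1 !scale1r. Qed.

Lemma astar0 : astar (0 : A) = 0.
Proof. by apply: (addrI (astar 0)); rewrite -astarD !addr0. Qed.

Lemma astarZ l a : astar (l *: a) = Num.conj l *: astar a.
Proof. by have := astarP l a 0; rewrite astar0 !addr0. Qed.

End StarAlgebra.

(* A general H*-algebra may have a nonzero annihilator, but by
   [<ab, d> = <a, d b^*>] the annihilator is orthogonal to the trace class. *)
Lemma coef_range_annihilator (R : realType) (A : coef_algebra R)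
    (l : R[i]) (b c : A) :
  coef_range b -> coef_range c ->
  (forall a : A, amul (b - l *: c) a = 0) -> b = l *: c.
Proof.
case: A b c => A /= b c.
- move=> _ _ ann; apply/eqP; rewrite -subr_eq0.
  (* For [d = b - l c] annihilation gives [d d^* = 0], and the C*-identity at [d^*] forces
     [d^* = 0]. *)
  have: amul (b - l *: c) (astar (b - l *: c)) = 0 by exact: ann.
  move: (b - l *: c) => d dd0; rewrite -[d]astarK.
  have: `|astar d| ^+ 2 = 0 by rewrite -cstar_identity astarK dd0 normr0.
  by move=> /eqP; rewrite sqrf_eq0 normr_eq0 => /eqP ->; rewrite astar0.
- move=> [b1 [b2 Eb]] [c1 [c2 Ec]] ann.
  have hip0 a : hip a (0 : A) = 0.
    have := hip_linearl 1 (0 : A) 0 a.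
    rewrite scale1r addr0 mul1r => /eqP; rewrite addrC -subr_eq subrr => /eqP.
    by rewrite (hip_conj 0 a) => <-; rewrite conjC0.
  have orth u v : hip (amul u v) (b - l *: c) = 0.
    by rewrite hip_adjr (_ : amul _ _ = 0) ?hip0 //; exact: ann.
  (* Both [b] and [c] are products, hence orthogonal to [b - l c]. *)
  have dd0 : hip (b - l *: c) (b - l *: c) = 0.
    rewrite -{1}scaleNr {1}addrC hip_linearl.
    by rewrite {1}Ec orth mulr0 add0r {1}Eb orth.
  by apply/eqP; rewrite -subr_eq0 -normr_eq0 hip_norm dd0 sqrtC0.
Qed.

(** * Sesquilinearity of the generalized inner product and linearity of morphisms *)

Section GeneralizedInnerProduct.
Variables (R : realType) (A : coef_algebra R) (W : hilbert_module A).
Implicit Types (x y z : W) (l : R[i]).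

Lemma inner0r x : inner x 0 = 0.
Proof. by apply: (addrI (inner x 0)); rewrite -innerDr !addr0. Qed.

(** The axioms give compatibility with the action of [A], not with complex scalars. Passing the
    scalar through the action yields [<x, l y> a = <x, y (l a)> = l <x, y> a] for every [a], and the
    annihilator lemma removes [a]. *)
Lemma innerZr l x y : inner x (l *: y) = l *: inner x y.
Proof.
apply: coef_range_annihilator => [||a]; try exact: inner_range.
rewrite amulDl -scaleN1r amulZl -inner_act act_scaler inner_act.
by rewrite amulZr amulZl scaleN1r subrr.
Qed.

Lemma innerNr x y : inner x (- y) = - inner x y.
Proof. by rewrite -scaleN1r innerZr scaleN1r. Qed.

Lemma innerDl x y z : inner (x + y) z = inner x z + inner y z.
Proof. by rewrite -inner_star innerDr astarD !inner_star. Qed.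

Lemma innerZl l x y : inner (l *: x) y = Num.conj l *: inner x y.
Proof. by rewrite -inner_star innerZr astarZ inner_star. Qed.

Lemma innerNl x y : inner (- x) y = - inner x y.
Proof. by rewrite -scaleN1r innerZl rmorphN1 scaleN1r. Qed.

Lemma inner_sym0 x y : inner x y = 0 -> inner y x = 0.
Proof. by move=> xy0; rewrite -inner_star xy0 astar0. Qed.

Section Morphism.
Variables (V : set W) (phi : W -> W).
Hypotheses (hV : submodule V) (hphi : morphism_on V phi).

(** The defect of linearity is orthogonal to every [phi z] with [z] in [V]. It is itself a
    combination of such vectors, so its inner square vanishes. *)
Lemma morphism_linear l x y : V x -> V y ->
  phi (l *: x + y) = l *: phi x + phi y.
Proof.
case: hV => _ VD VZ _ Vx Vy.
have Vs : V (l *: x + y) by apply: VD => //; exact: VZ.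
apply/eqP; rewrite -subr_eq0; apply/eqP/inner_eq0.
have ip0 z : V z -> inner (phi z) (phi (l *: x + y) - (l *: phi x + phi y)) = 0.
  move=> Vz; rewrite innerDr innerNr innerDr innerZr !hphi // innerDr innerZr.
  by rewrite subrr.
by rewrite innerDl innerNl innerDl innerZl !ip0 // scaler0 addr0 subr0.
Qed.

End Morphism.
End GeneralizedInnerProduct.

(** * Odd and even orthogonally additive maps on [V + phi(V)] *)

Section OrthogonalPexider.
Variables (R : realType) (A : coef_algebra R) (W : hilbert_module A).
Variables (V : set W) (phi : W -> W) (G : zmodType).
Hypotheses (hV : submodule V) (hphi : morphism_on V phi).
Hypothesis hVperp : phi @` V `<=` orthocomplement V.
Hypothesis mul2I : injective (fun g : G => g *+ 2).
Implicit Types (f : W -> G) (l : R[i]).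

Local Notation W0 := (sum_set V (phi @` V)).

Lemma morphismB s t : V s -> V t -> phi (s - t) = phi s - phi t.
Proof.
move=> Vs Vt; rewrite addrC -scaleN1r (morphism_linear hV hphi) //.
by rewrite scaleN1r addrC.
Qed.

Lemma morphism0 : phi 0 = 0.
Proof.
by case: (hV) => V0 _ _ _; have := morphismB V0 V0; rewrite !subrr.
Qed.

Lemma morphismN s : V s -> phi (- s) = - phi s.
Proof.
by case: (hV) => V0 _ _ _ Vs; rewrite -sub0r morphismB // morphism0 sub0r.
Qed.

Lemma morphismZ l s : V s -> phi (l *: s) = l *: phi s.
Proof.
move=> Vs; case: (hV) => V0 _ _ _.
by have := morphism_linear hV hphi l Vs V0; rewrite morphism0 !addr0.
Qed.

Lemma morphismD s t : V s -> V t -> phi (s + t) = phi s + phi t.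
Proof.
by move=> Vs Vt; have := morphism_linear hV hphi 1 Vs Vt; rewrite !scale1r.
Qed.

Lemma submodule_scale l s : V s -> V (l *: s).
Proof. by case: hV => _ _ VZ _; exact: VZ. Qed.

Lemma submoduleN s : V s -> V (- s).
Proof. by rewrite -scaleN1r; exact: submodule_scale. Qed.

Lemma submoduleD s t : V s -> V t -> V (s + t).
Proof. by case: hV => _ VD _ _; exact: VD. Qed.

Lemma submoduleB s t : V s -> V t -> V (s - t).
Proof. by move=> Vs Vt; apply: submoduleD => //; exact: submoduleN. Qed.

Lemma inner_morphism_scale l s t : V s -> V t -> inner s (l *: phi t) = 0.
Proof.
move=> Vs Vt; rewrite innerZr (_ : inner _ _ = 0) ?scaler0 //.
by apply: inner_sym0; apply: hVperp => //; exists t.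
Qed.

Lemma orthogonally_additive_split f l s t : orthogonally_additive f ->
  V s -> V t -> f (s + l *: phi t) = f s + f (l *: phi t).
Proof. by move=> fD Vs Vt; apply: fD; exact: inner_morphism_scale. Qed.

Lemma orthogonal_pexider f l s t : orthogonally_additive f ->
  Num.conj l * l = 1 -> V s -> V t ->
  f (s + t) + f (l *: phi (s - t)) =
  (f s + f (l *: phi s)) + (f t + f (- (l *: phi t))).
Proof.
move=> fD l1 Vs Vt.
(* The two occurrences of [<s, t>] cancel. *)
have orth : inner (s + l *: phi s) (t - l *: phi t) = 0.
  rewrite innerDr innerNr !innerDl (inner_morphism_scale l Vs Vt).
  rewrite (inner_sym0 (inner_morphism_scale l Vt Vs)) add0r addr0.
  by rewrite innerZl innerZr scalerA l1 scale1r hphi // subrr.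
(* The sum of the two orthogonal vectors regroups as [(s + t) + l phi(s - t)], again an orthogonal
   sum; [f] is evaluated both ways. *)
rewrite -(@orthogonally_additive_split f l (s + t) (s - t)) //;
  [|exact: submoduleD|exact: submoduleB].
rewrite morphismB // scalerBr addrACA fD // orthogonally_additive_split //.
congr (_ + _).
by rewrite -scaleNr orthogonally_additive_split.
Qed.

Lemma orthogonally_additive0 f : orthogonally_additive f -> f 0 = 0.
Proof.
by move=> fD; apply: (addrI (f 0)); rewrite -fD ?inner0r // !addr0.
Qed.

Lemma odd_orthogonally_additive f : orthogonally_additive f ->
  (forall x, f (- x) = - f x) -> additive_on W0 f.
Proof.
move=> fD fN.
have cj1 : Num.conj (1 : R[i]) * 1 = 1 by rewrite conjC1 mulr1.
have fV s t : V s -> V t -> f (s + t) = f s + f t.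
  move=> Vs Vt; apply: mul2I => /=.
  have E1 := orthogonal_pexider fD cj1 Vs Vt.
  have E2 := orthogonal_pexider fD cj1 Vt Vs.
  (* By oddness the two values at [phi(s - t)] and [phi(t - s)] cancel, as do those at [phi s] and
     [- phi s], and at [phi t] and [- phi t]. *)
  have := congr2 +%R E1 E2.
  rewrite !scale1r (addrC t) -[t - s]opprB morphismN; last exact: submoduleB.
  rewrite !fN addrACA subrr addr0 -mulr2n => ->.
  rewrite (AC ((2*2)*(2*2)) ((1*3)*(7*5)*((2*8)*(6*4)))) /=.
  by rewrite !subrr !addr0 mulr2n.
have fphi s t : V s -> V t -> f (phi s + phi t) = f (phi s) + f (phi t).
  (* With [- t] for [t] the equation involves [phi(s + t)]; additivity on [V] cancels the terms
     outside [phi(V)]. *)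
  move=> Vs Vt; have := orthogonal_pexider fD cj1 Vs (submoduleN Vt).
  rewrite !scale1r (morphismN Vt) !opprK morphismD // fV //; last first.
    exact: submoduleN.
  by rewrite fN addrACA => /addrI.
move=> x y [s [_ [Vs [s' Vs' <-] ->]]] [t [_ [Vt [t' Vt' <-] ->]]].
have split u v (Vu : V u) (Vv : V v) : f (u + phi v) = f u + f (phi v).
  by have := orthogonally_additive_split 1 fD Vu Vv; rewrite !scale1r.
rewrite addrACA -morphismD // split ?split //; try exact: submoduleD.
by rewrite morphismD // fphi // fV // addrACA.
Qed.

Lemma even_orthogonally_additive_morphism f l s : orthogonally_additive f ->
  (forall x, f (- x) = f x) -> Num.conj l * l = 1 -> V s ->
  f (l *: phi s) = f s.
Proof.
(* Half of [s] is used because the equation at [(r, r)] and [(r, - r)] produces the values at [2 r]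
   and [l phi(2 r)]; the right-hand sides agree. *)
move=> fD fN l1 Vs; pose r := 2^-1 *: s.
have Vr : V r by exact: submodule_scale.
have rr : r + r = s.
  by rewrite -mulr2n -scaler_nat scalerA divff ?scale1r ?pnatr_eq0.
have := orthogonal_pexider fD l1 Vr Vr.
rewrite subrr morphism0 scaler0 orthogonally_additive0 // addr0 rr fN => ->.
have := orthogonal_pexider fD l1 Vr (submoduleN Vr).
rewrite subrr orthogonally_additive0 // add0r opprK rr => ->.
by rewrite morphismN // scalerN opprK fN.
Qed.

Lemma even_orthogonally_additive_quadratic f x y : orthogonally_additive f ->
  (forall x, f (- x) = f x) -> W0 x -> W0 y ->
  f (x + y) + f (x - y) = f x *+ 2 + f y *+ 2.
Proof.
move=> fD fN.
have cj1 : Num.conj (1 : R[i]) * 1 = 1 by rewrite conjC1 mulr1.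
have fphi v (Vv : V v) : f (phi v) = f v.
  have := even_orthogonally_additive_morphism fD fN cj1 Vv.
  by rewrite scale1r.
have fV s t : V s -> V t -> f (s + t) + f (s - t) = f s *+ 2 + f t *+ 2.
  move=> Vs Vt; have := orthogonal_pexider fD cj1 Vs Vt.
  by rewrite !scale1r fN !fphi //; exact: submoduleB.
(* On [W0] the map is a sum of its values at the two [V]-coordinates, so the parallelogram law holds
   coordinatewise. *)
have split u v (Vu : V u) (Vv : V v) : f (u + phi v) = f u + f v.
  have := orthogonally_additive_split 1 fD Vu Vv.
  by rewrite !scale1r [f (phi v)]fphi.
move=> [s [_ [Vs [s' Vs' <-] ->]]] [t [_ [Vt [t' Vt' <-] ->]]].
rewrite opprD addrACA -morphismD // [X in _ + f X]addrACA -morphismB //.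
rewrite !split //; try exact: submoduleD; try exact: submoduleB.
by rewrite addrACA !fV // !mulrnDl addrACA.
Qed.

Lemma even_orthogonally_additive_imaginary f x : orthogonally_additive f ->
  (forall x, f (- x) = f x) -> W0 x -> f ('i *: x) = f x.
Proof.
move=> fD fN [s [_ [Vs [t Vt <-] ->]]].
have cj1 : Num.conj (1 : R[i]) * 1 = 1 by rewrite conjC1 mulr1.
have cji : Num.conj ('i : R[i]) * 'i = 1.
  by rewrite conjCi mulNr -expr2 sqrCi opprK.
have fphi1 v (Vv : V v) : f (phi v) = f v.
  have := even_orthogonally_additive_morphism fD fN cj1 Vv.
  by rewrite scale1r.
have fphii v (Vv : V v) := even_orthogonally_additive_morphism fD fN cji Vv.
rewrite scalerDr orthogonally_additive_split ?fphii //;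
  last exact: submodule_scale.
rewrite -[phi t]scale1r orthogonally_additive_split // scale1r fphi1 //.
(* On [V] the factor [i] disappears through [f(i s) = f(phi(i s)) = f(i phi(s)) = f(s)], using
   [l = 1] and then [l = i]. *)
rewrite -[X in X + _]fphi1 ?morphismZ ?fphii //; exact: submodule_scale.
Qed.

End OrthogonalPexider.

(** * Polarization of a quadratic map between abelian groups *)

Section Polarization.
Variables (M G : zmodType) (D : set M) (q : M -> G).
Hypothesis mul2I : injective (fun g : G => g *+ 2).
Hypothesis DB : forall x y, D x -> D y -> D (x - y).
Hypothesis q_even : forall x, q (- x) = q x.
Hypothesis q_quadratic : forall x y, D x -> D y ->
  q (x + y) + q (x - y) = q x *+ 2 + q y *+ 2.

(** This is four times the biadditive form attached to [q]; keeping the factor avoids division in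
    [G] here. *)
Definition polar x y := q (x + y) - q (x - y).

Lemma polarC x y : polar x y = polar y x.
Proof. by rewrite /polar [x + y]addrC -[x - y]opprB q_even. Qed.

Lemma subr_closedD u v : D u -> D v -> D (u + v).
Proof.
move=> Du Dv; rewrite -[v]opprK; apply: (DB Du).
by rewrite -sub0r; apply: DB => //; rewrite -(subrr u); exact: DB.
Qed.

(** Subtract the parallelogram laws for the pairs [(x + z, y + z)] and [(x - z, y - z)]: the common
    term [q (x - y)] cancels. *)
Lemma polar_double x y z : D x -> D y -> D z ->
  (polar x z + polar y z) *+ 2 = polar (x + y) (z + z).
Proof.
move=> Dx Dy Dz.
have Ep := q_quadratic (subr_closedD Dx Dz) (subr_closedD Dy Dz).
have Em := q_quadratic (DB Dx Dz) (DB Dy Dz).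
have subDz u : x + u - (y + u) = x - y by rewrite opprD addrACA subrr addr0.
rewrite addrACA subDz in Ep; rewrite addrACA subDz -opprD in Em.
rewrite /polar addrACA -opprD mulrnBl !mulrnDl -Ep -Em [- (q _ + _)]opprD.
by rewrite [LHS]addrACA subrr addr0.
Qed.

Lemma polarDl x y z : D x -> D y -> D z ->
  polar (x + y) z = polar x z + polar y z.
Proof.
move=> Dx Dy Dz; have D0 : D 0 by rewrite -(subrr x); exact: DB.
(* The case [y = 0] of [polar_double] trades the doubling of the value for a doubling of [z]. *)
have polar2 u : D u -> polar u z *+ 2 = polar u (z + z).
  move=> Du; have := polar_double Du D0 Dz.
  by rewrite /polar add0r sub0r q_even subrr !addr0.
apply: mul2I => /=; by rewrite polar_double // polar2 //; exact: subr_closedD.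
Qed.

Lemma polarDr x y z : D x -> D y -> D z ->
  polar x (y + z) = polar x y + polar x z.
Proof. by move=> *; rewrite polarC polarDl // !(polarC x). Qed.

Lemma polar_diag x : D x -> polar x x = q x *+ 4.
Proof.
move=> Dx; have := q_quadratic Dx Dx; rewrite /polar.
(* The law at [(0, 0)], with 0 obtained as [x - x], gives [q 0 = 0]. *)
have := q_quadratic (DB Dx Dx) (DB Dx Dx); rewrite subrr addr0 subrr.
move=> E; have q0 : q 0 = 0.
  by apply: mul2I; apply: (addrI (q 0 *+ 2)); rewrite /= -E mul0rn addr0 mulr2n.
by rewrite q0 addr0 subr0 -mulrnDr.
Qed.

End Polarization.

(* [u] is additive, so it is rational-homogeneous, and continuity at [0]
   extends this to real scalars by density.  The topology on scalars is that
   of [R[i]^o], since [R[i]] itself carries none. *)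
Lemma additive_continuous_real (R : realType) (G : normedModType R[i])
    (u : R[i]^o -> G) (r : R) :
  {morph u : x y / x + y} -> continuous u -> u r%:C = r%:C *: u 1.
Proof.
move=> uD uc.
have u0 : u 0 = 0 by apply: (addrI (u 0)); rewrite -uD !addr0.
have uN x : u (- x) = - u x.
  by apply: (addrI (u x)); rewrite -uD !subrr.
have uMn x n : u (x *+ n) = u x *+ n.
  by elim: n => [|n IHn]; rewrite ?mulr0n // !mulrS uD IHn.
have uMz x (n : int) : u (x *~ n) = u x *~ n.
  by case: n => n; rewrite ?NegzE ?mulrNz ?uN -?pmulrn uMn.
have uQ (p : rat) : u (ratr p) = ratr p *: u 1.
  have dn0 : (denq p)%:~R != 0 :> R[i] by rewrite intr_eq0 denq_neq0.
  apply: (scalerI dn0); rewrite scaler_int -uMz scalerA.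
  rewrite -[ratr p *~ _]mulrzr /ratr mulfVK // mulrCA divff // mulr1.
  by rewrite uMz scaler_int.
(* The defect [v] is additive, vanishes at rationals and is continuous at 0. *)
pose v x := u x - x *: u 1.
have vQ (p : rat) : v (ratr p) = 0 by rewrite /v uQ subrr.
have vB x y : v (x - y) = v x - v y.
  by rewrite /v uD uN scalerBl !opprB (AC (2*2) ((1*4)*(3*2))).
have vc : v x @[x --> (0 : R[i]^o)] --> v 0.
  exact: cvgB (uc 0) (@scalel_continuous _ G (u 1) 0).
apply/eqP; rewrite -subr_eq0 -[_ - _]/(v r%:C).
apply: contraT; rewrite -normr_gt0 => v_gt0.
have v0 : v 0 = 0 by have := vB 0 0; rewrite !subrr.
(* Near 0, [|v|] stays below [|v r|]; a rational [p] close to [r] contradicts this, since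
   [v (r - p) = v r]. *)
rewrite v0 in vc; have /cvgr0Pnorm_lt/(_ _ v_gt0)/nbhs_norm0P[] := vc.
move=> [d d'] /= d_gt0 vd.
(* The radius is a positive element of [R[i]], hence real. *)
have [d'0 dr_gt0] : d' = 0 /\ 0 < d.
  by move: d_gt0; rewrite ltcE /= => /andP[/eqP -> ->].
have [p] : exists p : rat, ratr p \in `]r - d, r[%R.
  by apply: rat_in_itvoo; rewrite ltrBlDr ltrDl.
rewrite in_itv /= => /andP[rp pr].
suff small : `|r%:C - ratr p| < d +i* d'.
  have : `|v (r%:C - ratr p)| < `|v r%:C| by exact: (vd _ small).
  by rewrite vB vQ subr0 ltxx.
rewrite -(fmorph_rat (real_complex R)). rewrite -rmorphB.
have rp_ge0 : 0 <= r - ratr p by rewrite subr_ge0 ltW.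
rewrite ger0_norm; last by rewrite ler0c.
by rewrite d'0 ltcR ltrBlDr -ltrBlDl.
Qed.

(** The factor [c] is [i] in the linear variable and [- i] in the conjugate linear one. *)
Lemma additive_continuous_complex (R : realType) (G : normedModType R[i])
    (u : R[i]^o -> G) (c l : R[i]) :
  {morph u : x y / x + y} -> continuous u ->
  (forall x, u ('i * x) = c *: u x) ->
  u l = ((complex.Re l)%:C + c * (complex.Im l)%:C) *: u 1.
Proof.
move=> uD uc ui; rewrite [in LHS](complexE l) complexiE uD ui.
rewrite (additive_continuous_real (complex.Re l) uD uc).
by rewrite (additive_continuous_real (complex.Im l) uD uc) scalerDl scalerA.
Qed.

(** * Halving, and the odd and even parts of a map *)

Section Halving.
Variables (M G : zmodType) (half : G -> G).
Hypothesis halfK : forall g, half g *+ 2 = g.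
Hypothesis mul2I : injective (fun g : G => g *+ 2).

Lemma halfD g h : half (g + h) = half g + half h.
Proof. by apply: mul2I; rewrite /= mulrnDl !halfK. Qed.

Lemma halfN g : half (- g) = - half g.
Proof. by apply: mul2I; rewrite /= mulNrn !halfK. Qed.

Lemma half0 : half 0 = 0.
Proof. by apply: mul2I; rewrite /= halfK mul0rn. Qed.

Lemma half_mul2 g : half (g *+ 2) = g.
Proof. by apply: mul2I; rewrite /= halfK. Qed.

Definition odd_part (f : M -> G) x := half (f x - f (- x)).
Definition even_part (f : M -> G) x := half (f x + f (- x)).
Definition quarter_polar (q : M -> G) x y := half (half (polar q x y)).

Lemma odd_partN f x : odd_part f (- x) = - odd_part f x.
Proof. by rewrite /odd_part opprK -halfN opprB. Qed.

Lemma even_partN f x : even_part f (- x) = even_part f x.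
Proof. by rewrite /even_part opprK addrC. Qed.

Lemma odd_even_part f x : f x = odd_part f x + even_part f x.
Proof. by rewrite -halfD addrACA addNr addr0 -mulr2n half_mul2. Qed.

End Halving.

(** * The additive and biadditive parts of an orthogonally additive map *)

Section Decomposition.
Variables (R : realType) (A : coef_algebra R) (W : hilbert_module A).
Variables (V : set W) (phi : W -> W) (G : zmodType) (half : G -> G).
Hypotheses (hV : submodule V) (hphi : morphism_on V phi).
Hypothesis hVperp : phi @` V `<=` orthocomplement V.
Hypothesis halfK : forall g, half g *+ 2 = g.
Hypothesis mul2I : injective (fun g : G => g *+ 2).

Local Notation W0 := (sum_set V (phi @` V)).

Lemma sum_morphism_scale l x : W0 x -> W0 (l *: x).
Proof.
move=> [s [_ [Vs [t Vt <-] ->]]]; exists (l *: s), (phi (l *: t)).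
split; [exact: submodule_scale | |by rewrite (morphismZ hV hphi) // scalerDr].
by exists (l *: t) => //; exact: submodule_scale.
Qed.

Lemma sum_morphismB x y : W0 x -> W0 y -> W0 (x - y).
Proof.
move=> [s [_ [Vs [s' Vs' <-] ->]]] [t [_ [Vt [t' Vt' <-] ->]]].
exists (s - t), (phi (s' - t')); split; first exact: submoduleB.
  by exists (s' - t') => //; exact: submoduleB.
by rewrite (morphismB hV hphi) // opprD addrACA.
Qed.

Variable f : W -> G.
Hypothesis fD : orthogonally_additive f.

Let T := odd_part half f.
Let E := even_part half f.
Let B := quarter_polar half E.

Let TD : orthogonally_additive T.
Proof.
move=> x y xy0; rewrite /T /odd_part -(halfD halfK mul2I) opprD !fD //.
  by rewrite opprD addrACA.
by rewrite innerNl innerNr opprK.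
Qed.

Let ED : orthogonally_additive E.
Proof.
move=> x y xy0; rewrite /E /even_part -(halfD halfK mul2I) opprD !fD //.
  by rewrite addrACA.
by rewrite innerNl innerNr opprK.
Qed.

Let EN : forall x, E (- x) = E x.
Proof. exact: even_partN. Qed.

Lemma odd_part_additive : additive_on W0 T.
Proof.
apply: odd_orthogonally_additive => // x; exact: odd_partN.
Qed.

Lemma even_part_imaginary x : W0 x -> E ('i *: x) = E x.
Proof. exact: (even_orthogonally_additive_imaginary hV hphi hVperp ED EN). Qed.

Let Eq x y (Wx : W0 x) (Wy : W0 y) :=
  even_orthogonally_additive_quadratic hV hphi hVperp ED EN Wx Wy.

Lemma quarter_polar_sym x y : B x y = B y x.
Proof. by rewrite /B /quarter_polar polarC. Qed.

Lemma quarter_polar_biadditive : biadditive_on W0 B.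
Proof.
move=> x y z Wx Wy Wz; rewrite /B /quarter_polar.
rewrite (polarDl mul2I sum_morphismB EN Eq) //.
by rewrite (polarDr mul2I sum_morphismB EN Eq) // !(halfD halfK mul2I).
Qed.

(** If [x] is orthogonal to [y], it is orthogonal to [- y] too, so [E (x + y)] and [E (x - y)] both
    equal [E x + E y]. *)
Lemma quarter_polar_orthogonal x y : inner x y = 0 -> B x y = 0.
Proof.
move=> xy0; rewrite /B /quarter_polar /polar !ED ?innerNr ?xy0 ?oppr0 // EN.
by rewrite subrr !(half0 halfK mul2I).
Qed.

Lemma odd_part_quarter_polar x : W0 x -> f x = T x + B x x.
Proof.
move=> Wx; rewrite [LHS](odd_even_part halfK mul2I f x); congr (_ + _).
rewrite /B /quarter_polar (polar_diag mul2I sum_morphismB Eq) //.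
by rewrite (mulrnA _ 2 2) !(half_mul2 halfK mul2I).
Qed.

Lemma quarter_polar_imaginary x y : W0 x -> W0 y ->
  B ('i *: x) ('i *: y) = B x y.
Proof.
move=> Wx Wy.
rewrite /B /quarter_polar /polar -scalerDr -scalerBr.
rewrite !even_part_imaginary //; first exact: sum_morphismB.
exact: (subr_closedD sum_morphismB).
Qed.

Lemma quarter_polarNl x y : B (- x) y = - B x y.
Proof.
have polarNl : polar E (- x) y = - polar E x y.
  by rewrite /polar opprB -[- x - y]opprD EN (addrC (- x)) -[y - x]opprB EN.
by rewrite /B /quarter_polar polarNl !(halfN halfK mul2I).
Qed.

Lemma quarter_polarNr x y : B x (- y) = - B x y.
Proof. by rewrite quarter_polar_sym quarter_polarNl quarter_polar_sym. Qed.

End Decomposition.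

(** * The continuous case: complexification to a sesquilinear map *)

Section Sesquilinear.
Variables (R : realType) (A : coef_algebra R) (W : hilbert_module A).
Variables (V : set W) (phi : W -> W) (G : normedModType R[i]) (f : W -> G).
Hypotheses (hV : submodule V) (hphi : morphism_on V phi).
Hypothesis hVperp : phi @` V `<=` orthocomplement V.
Hypotheses (fD : orthogonally_additive f) (fc : continuous f).

Local Notation W0 := (sum_set V (phi @` V)).

(** An explicit scaling, so that continuity of [f] passes to [T], [E] and [B]. *)
Let half (g : G) : G := 2^-1 *: g.

Let halfK g : half g *+ 2 = g.
Proof. by rewrite -scaler_nat scalerA divff ?scale1r // pnatr_eq0. Qed.

Let mul2I : injective (fun g : G => g *+ 2).
Proof.
move=> g h /= gh; have n2 : (2 : R[i]) != 0 by rewrite pnatr_eq0.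
by apply: (scalerI n2); rewrite !scaler_nat.
Qed.

Let T := odd_part half f.
Let E := even_part half f.
Let B := quarter_polar half E.

(* Since [B (i x) (i y) = B x y] on [W0], this is the usual complexification
   of a real bilinear form. *)
Definition sesqui x y : G := B x y + 'i *: B x ('i *: y).

Let oppr_continuous : continuous (fun x : W => - x).
Proof. by move=> x; apply: cvgN; exact: cvg_id. Qed.

Let fNc : continuous (fun x => f (- x)).
Proof.
by move=> x; apply: continuous_comp; [exact: oppr_continuous|exact: fc].
Qed.

Lemma odd_part_continuous : continuous T.
Proof.
by move=> x; apply: cvgZl_tmp; exact: cvgB (@fc x) (@fNc x).
Qed.

Lemma even_part_continuous : continuous E.
Proof.
by move=> x; apply: cvgZl_tmp; exact: cvgD (@fc x) (@fNc x).
Qed.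

Lemma quarter_polar_cvg (U : topologicalType) (g h : U -> W) (u : U) :
  {for u, continuous g} -> {for u, continuous h} ->
  {for u, continuous (fun t => B (g t) (h t))}.
Proof.
move=> gc hc.
have pc : E (g t + h t) @[t --> u] --> E (g u + h u).
  exact: continuous_cvg (@even_part_continuous _) (cvgD gc hc).
have mc : E (g t - h t) @[t --> u] --> E (g u - h u).
  exact: continuous_cvg (@even_part_continuous _) (cvgB gc hc).
exact: cvgZl_tmp (cvgZl_tmp (cvgB pc mc)).
Qed.

(** Continuity along arbitrary maps [g] and [h] covers both joint continuity and continuity in a
    scalar multiplying one argument. *)
Lemma sesqui_cvg (U : topologicalType) (g h : U -> W) (u : U) :
  {for u, continuous g} -> {for u, continuous h} ->
  {for u, continuous (fun t => sesqui (g t) (h t))}.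
Proof.
move=> gc hc; have ic : {for u, continuous (fun t => 'i *: h t)}.
  exact: cvgZl_tmp hc.
exact: cvgD (quarter_polar_cvg gc hc) (cvgZl_tmp (quarter_polar_cvg gc ic)).
Qed.

Let W0Z := sum_morphism_scale hV hphi.

Let BD := quarter_polar_biadditive hV hphi hVperp halfK mul2I fD.
Let BNl := quarter_polarNl halfK mul2I f.
Let BNr := quarter_polarNr halfK mul2I f.
Let Bi := quarter_polar_imaginary hV hphi hVperp halfK mul2I fD.
Let Bsym : forall x y, B x y = B y x := quarter_polar_sym half f.

Lemma sesquiDl x y z : W0 x -> W0 y -> W0 z ->
  sesqui (x + y) z = sesqui x z + sesqui y z.
Proof.
move=> Wx Wy Wz; rewrite /sesqui /B (BD Wx Wy Wz).1 (BD Wx Wy (W0Z 'i Wz)).1.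
by rewrite scalerDr addrACA.
Qed.

Lemma sesquiDr x y z : W0 x -> W0 y -> W0 z ->
  sesqui x (y + z) = sesqui x y + sesqui x z.
Proof.
move=> Wx Wy Wz; rewrite /sesqui /B (BD Wx Wy Wz).2 [in LHS]scalerDr.
by rewrite (BD Wx (W0Z 'i Wy) (W0Z 'i Wz)).2 scalerDr addrACA.
Qed.

Let scale_ii (M : lmodType R[i]) (x : M) : 'i *: ('i *: x) = - x.
Proof. by rewrite scalerA -expr2 sqrCi scaleN1r. Qed.

Let B_swap x y : W0 x -> W0 y -> B ('i *: x) y = - B x ('i *: y).
Proof.
(* [B(i x, y) = B(i i x, i y) = B(- x, i y)]. *)
by move=> Wx Wy; rewrite /B -(Bi (W0Z 'i Wx) Wy) scale_ii BNl.
Qed.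

Lemma sesqui_imaginaryl x y : W0 x -> W0 y ->
  sesqui ('i *: x) y = 'i *: sesqui x y.
Proof.
move=> Wx Wy; rewrite /sesqui B_swap // [B ('i *: x) _]Bi //.
by rewrite scalerDr scale_ii addrC.
Qed.

Lemma sesqui_imaginaryr x y : W0 x -> W0 y ->
  sesqui x ('i *: y) = - 'i *: sesqui x y.
Proof.
move=> Wx Wy; rewrite /sesqui scale_ii [B x (- y)]BNr.
by rewrite scalerN scalerDr !scaleNr scale_ii opprK addrC.
Qed.

Let scale_continuous_l (x : W) : continuous (fun l : R[i]^o => l *: x).
Proof. exact: scalel_continuous. Qed.

Lemma sesquiZl l x y : W0 x -> W0 y -> sesqui (l *: x) y = l *: sesqui x y.
Proof.
(* Homogeneity becomes a statement about an additive continuous function of the scalar alone. *)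
move=> Wx Wy; pose u (k : R[i]^o) := sesqui (k *: x) y.
have uD : {morph u : a b / a + b}.
  by move=> a b; rewrite /u scalerDl sesquiDl //; exact: W0Z.
have uc : continuous u.
  move=> k.
  exact: sesqui_cvg (@scale_continuous_l x k) (@cst_continuous _ _ y k).
have ui k : u ('i * k) = 'i *: u k.
  by rewrite /u -scalerA sesqui_imaginaryl //; exact: W0Z.
rewrite -[LHS]/(u l) (additive_continuous_complex l uD uc ui) /u scale1r.
by rewrite -complexiE -complexE.
Qed.

Lemma sesquiZr l x y : W0 x -> W0 y ->
  sesqui x (l *: y) = Num.conj l *: sesqui x y.
Proof.
move=> Wx Wy; pose u (k : R[i]^o) := sesqui x (k *: y).
have uD : {morph u : a b / a + b}.
  by move=> a b; rewrite /u scalerDl sesquiDr //; exact: W0Z.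
have uc : continuous u.
  move=> k.
  exact: sesqui_cvg (@cst_continuous _ _ x k) (@scale_continuous_l y k).
have ui k : u ('i * k) = - 'i *: u k.
  by rewrite /u -scalerA sesqui_imaginaryr //; exact: W0Z.
rewrite -[LHS]/(u l) (additive_continuous_complex l uD uc ui) /u scale1r.
congr (_ *: _); rewrite -complexiE; case: l => a b /=.
by apply/eqP; rewrite eq_complex /=; simpc.
Qed.

Lemma sesqui_diag x : W0 x -> sesqui x x = B x x.
Proof.
move=> Wx; have B0 : B x ('i *: x) = 0.
  (* By symmetry and [B_swap], [B(x, i x)] equals its own opposite. *)
  apply: mul2I; rewrite /= mul0rn mulr2n -{1}[B x _]opprK -B_swap // Bsym.
  by rewrite addNr.
by rewrite /sesqui B0 scaler0 addr0.
Qed.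

Lemma sesqui_orthogonal x y : inner x y = 0 -> sesqui x y = 0.
Proof.
move=> xy0; rewrite /sesqui /B !(quarter_polar_orthogonal halfK mul2I fD) //.
  by rewrite scaler0 addr0.
by rewrite innerZr xy0 scaler0.
Qed.

Lemma continuous_orthogonally_additive_decomposition :
  exists (T : W -> G) (S : W -> W -> G),
    [/\ continuous T /\ continuous (fun p : W * W => S p.1 p.2),
        additive_on W0 T, sesquilinear_on W0 S,
        orthogonality_preserving_on W0 S &
        forall x, W0 x -> f x = T x + S x x].
Proof.
exists T, sesqui; split.
- split; first exact: odd_part_continuous.
  by move=> p; exact: sesqui_cvg (@cvg_fst _ _ (nbhs p.1) (nbhs p.2) _)
    (@cvg_snd _ _ (nbhs p.1) (nbhs p.2) _).
- exact: (odd_part_additive hV hphi hVperp halfK mul2I fD).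
- move=> l x y z Wx Wy Wz; split.
    by rewrite sesquiDl // ?sesquiZl //; exact: W0Z.
  by rewrite sesquiDr // ?sesquiZr //; exact: W0Z.
- by move=> x y _ _; exact: sesqui_orthogonal.
- move=> x Wx; rewrite sesqui_diag //.
  exact: (odd_part_quarter_polar hV hphi hVperp halfK mul2I fD).
Qed.

End Sesquilinear.

Theorem theorem3p1 (R : realType) (A : coef_algebra R) (W : hilbert_module A)
    (V : set W) (phi : W -> W)
    (hV : submodule V) (hphi : morphism_on V phi)
    (hVperp : phi @` V `<=` orthocomplement V) :
  let W0 := sum_set V (phi @` V) in
  (forall (G : zmodType) (f : W -> G),
     uniquely_2_divisible G -> orthogonally_additive f ->
     exists (T : W -> G) (B : W -> W -> G),
       [/\ additive_on W0 T, symmetric_on W0 B, biadditive_on W0 B,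
           orthogonality_preserving_on W0 B &
           forall x, W0 x -> f x = T x + B x x]) /\
  (forall (G : normedModType R[i]) (f : W -> G),
     orthogonally_additive f -> continuous f ->
     exists (T : W -> G) (S : W -> W -> G),
       [/\ continuous T /\ continuous (fun p : W * W => S p.1 p.2),
           additive_on W0 T, sesquilinear_on W0 S,
           orthogonality_preserving_on W0 S &
           forall x, W0 x -> f x = T x + S x x]).
Proof.
split=> [G f G2 fD|G f fD fc]; last first.
  exact: (continuous_orthogonally_additive_decomposition hV hphi hVperp fD fc).
have /choice[half halfK] : forall g : G, exists h, h *+ 2 = g.
  by move=> g; have [h []] := G2 g; exists h.
(* Uniqueness of halves is injectivity of doubling. *)
have mul2I : injective (fun g : G => g *+ 2).
  move=> g h /= gh; have [k [_ uniq_k]] := G2 (h *+ 2).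
  by rewrite -(uniq_k g gh) (uniq_k h).
exists (odd_part half f), (quarter_polar half (even_part half f)); split.
- exact: (odd_part_additive hV hphi hVperp halfK mul2I fD).
- by move=> x y _ _; exact: quarter_polar_sym.
- exact: (quarter_polar_biadditive hV hphi hVperp halfK mul2I fD).
- by move=> x y _ _; exact: (quarter_polar_orthogonal halfK mul2I fD).
- by move=> x; exact: (odd_part_quarter_polar hV hphi hVperp halfK mul2I fD).
Qed.
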